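(* Let $(L,\cdot,[\;,\;])$ be a transposed Poisson algebra and let $D$ be a derivation of both $(L,\cdot)$ and $(L,[\;,\;])$. Define a ternary operation on $L$ by $$[x,y,z]:=D(x)\cdot[y,z]+D(y)\cdot[z,x]+D(z)\cdot[x,y],\quad\forall x,y,z\in L.$$ Then $(L,[\;,\;,\;])$ is a 3-Lie algebra.
   Context: All vector spaces are over a field $K$ of characteristic zero. Commutative associative algebras are not assumed unital. Derivations are $K$-linear. A transposed Poisson algebra is a triple $(L,\cdot,[\;,\;])$ where $(L,\cdot)$ is a commutative associative algebra, $(L,[\;,\;])$ is a Lie algebra, and $2z\cdot[x,y]=[z\cdot x,y]+[x,z\cdot y]$ for all $x,y,z\in L$. A 3-Lie algebra is a vector space $A$ with a skew-symmetric trilinear map $[\;,\;,\;]:\otimes^3A\to A$ such that, for all $x,y,z,u,v\in A$, $$[[x,y,z],u,v]=[[x,u,v],y,z]+[[y,u,v],z,x]+[[z,u,v],x,y].$$ *)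

(* Defs.v *)
From HB Require Import structures.
From mathcomp Require Import all_boot all_order all_algebra.

Set Implicit Arguments.
Unset Strict Implicit.
Unset Printing Implicit Defensive.

Import GRing.Theory.
Local Open Scope ring_scope.

(* MathComp's ring types are unital, so a possibly non-unital algebra is a
   left module with a bundled bilinear operation. *)

Definition comm_assoc_algebra (K : fieldType) (L : lmodType K)
    (mul : {bilinear L -> L -> L}) : Prop :=
  commutative mul /\ associative mul.

Definition lie_algebra (K : fieldType) (L : lmodType K)
    (br : {bilinear L -> L -> L}) : Prop :=
  (forall x, br x x = 0) /\
  (forall x y z, br x (br y z) + br y (br z x) + br z (br x y) = 0).

Definition transposed_poisson_algebra (K : fieldType) (L : lmodType K)
    (mul br : {bilinear L -> L -> L}) : Prop :=
  [/\ comm_assoc_algebra mul,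
      lie_algebra br
    & forall x y z, mul z (br x y) *+ 2 = br (mul z x) y + br x (mul z y)].

Definition is_derivation (K : fieldType) (L : lmodType K)
    (op : {bilinear L -> L -> L}) (D : {linear L -> L}) : Prop :=
  forall x y, D (op x y) = op (D x) y + op x (D y).

Definition trilinear (K : fieldType) (L : lmodType K)
    (t : L -> L -> L -> L) : Prop :=
  [/\ forall y z, linear (fun x => t x y z),
      forall x z, linear (fun y => t x y z)
    & forall x y, linear (fun z => t x y z)].

(* The two adjacent transpositions generate the symmetric group S_3. *)
Definition skew_symmetric3 (K : fieldType) (L : lmodType K)
    (t : L -> L -> L -> L) : Prop :=
  (forall x y z, t y x z = - t x y z) /\ (forall x y z, t x z y = - t x y z).

Definition three_lie_algebra (K : fieldType) (A : lmodType K)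
    (t : A -> A -> A -> A) : Prop :=
  [/\ trilinear t,
      skew_symmetric3 t
    & forall x y z u v,
        t (t x y z) u v = t (t x u v) y z + t (t y u v) z x + t (t z u v) x y].

Definition ternary_op (K : fieldType) (L : lmodType K)
    (mul br : {bilinear L -> L -> L}) (D : {linear L -> L}) (x y z : L) : L :=
  mul (D x) (br y z) + mul (D y) (br z x) + mul (D z) (br x y).

(* Main.v *)
Require Import Defs.
From HB Require Import structures.
From mathcomp Require Import all_boot all_order all_algebra.

(** Write [xy] for the product of [x] and [y], and [x'] for [D x].  Everything
    rests on three consequences of the transposed Leibniz rule
    [2 z[x,y] = [zx,y] + [x,zy]] and of the Jacobi identity, in which the sums
    are cyclic in [x], [y], [z]:
    - [mul_br_cyclic]: [sum x[y,z] = 0], because the six terms of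
      [2 sum x[y,z]] cancel in pairs;
    - [br_mul_br_cyclic]: [sum [h[x,y],z] = 0]; calling this sum [S] and putting
      [T = sum [[x,y],hz]], the Jacobi identity multiplied by [h] gives
      [S + T = 0], while the transposed Leibniz rule inside the outer brackets
      of [2S] and the Jacobi identity give [2S + T = 0];
    - [br_mul_br_plucker]: [sum [h,x][y,z] = 0].

    In the fundamental identity
    [[[x,y,z],u,v] = [[x,u,v],y,z] + [[y,u,v],z,x] + [[z,u,v],x,y]],
    every expanded term has two occurrences of [D].  The terms of [D [x,y,z]] where one argument
    carries both add up to [sum x''[y,z]], and the other ones to
    [- sum x[y',z']] by [mul_br_cyclic]; this is [D_ternary].  After
    expansion, the terms are compared according to the arguments that carry [D]:
    - the terms in [x''], [y''], [z''] agree on both sides, those in [u''] or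
      [v''] vanish by [br_mul_br_plucker];
    - the terms in [u'] and [v'] together vanish by [mul_br_cyclic];
    - the terms in two of [x'], [y'], [z'] match by [mul_br_exchange];
    - the terms in one of [x'], [y'], [z'] and one of [u'], [v'] match by
      [mul_br_mul_br]. *)

Import GRing.Theory.
Local Open Scope ring_scope.

(** * Rearranging sums *)

Lemma addr_pull (V : zmodType) (t x r s : V) : r = t + s -> x + r = t + (x + s).
Proof. by move=> ->; rewrite addrCA. Qed.

Lemma addr_match (V : zmodType) (t a r s : V) : r = t + s -> a = s -> t + a = r.
Proof. by move=> -> ->. Qed.

(** Proves an equality of two sums in an abelian group that have the same
    terms up to order: the head of the left-hand sum is looked up in the
    right-hand one and removed on both sides, until nothing is left.  The final
    zero makes every term of a sum the head of some tail. *)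
Ltac sum_perm :=
  apply: (@addIr _ 0); rewrite -?addrA;
  repeat
    (lazymatch goal with
     | |- ?t + _ = _ =>
         let w := fresh in
         move: t => w;
         eapply addr_match;
         [ repeat (lazymatch goal with
                   | |- w + _ = _ => fail
                   | _ => eapply addr_pull
                   end);
           reflexivity
         | clear w ]
     end);
  reflexivity.

(** * Identities in transposed Poisson algebras *)

Section TransposedPoisson.

Variables (K : fieldType) (L : lmodType K) (mul br : {bilinear L -> L -> L}).
Hypothesis two_neq0 : 2%:R != 0 :> K.
Hypothesis tpL : transposed_poisson_algebra mul br.

Local Notation "x ** y" := (mul x y) (at level 40, left associativity).
Local Notation "[[ x , y ]]" := (br x y) (at level 0).

Lemma tp_mulC x y : x ** y = y ** x.
Proof. by case: tpL => -[mulC _] _ _; exact: mulC. Qed.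

Lemma tp_mulA x y z : x ** (y ** z) = x ** y ** z.
Proof. by case: tpL => -[_ mulA] _ _; exact: mulA. Qed.

Lemma tp_mulAC x y z : x ** y ** z = x ** z ** y.
Proof. by rewrite -!tp_mulA (tp_mulC y). Qed.

Lemma tp_leibniz x y z : (z ** [[x, y]]) *+ 2 = [[z ** x, y]] + [[x, z ** y]].
Proof. by case: tpL => _ _; exact. Qed.

Lemma br_antisym x y : [[x, y]] = - [[y, x]].
Proof.
case: tpL => _ [brxx _] _; apply/eqP; rewrite -addr_eq0; apply/eqP.
by have := brxx (x + y); rewrite linearDl !linearDr !brxx /= add0r addr0.
Qed.

Lemma br_jacobi x y z : [[x, [[y, z]]]] + [[y, [[z, x]]]] + [[z, [[x, y]]]] = 0.
Proof. by case: tpL => _ [_ jac] _; exact: jac. Qed.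

Lemma br_jacobi_l x y z :
  [[[[x, y]], z]] + [[[[y, z]], x]] + [[[[z, x]], y]] = 0.
Proof. by rewrite !(br_antisym [[_, _]]) -!opprD br_jacobi oppr0. Qed.

Lemma mulr2n_eq0 (w : L) : w *+ 2 = 0 -> w = 0.
Proof.
move/eqP; rewrite -scaler_nat scaler_eq0 (negbTE two_neq0) /=.
by move/eqP.
Qed.

Lemma mul_br_cyclic x y z : x ** [[y, z]] + y ** [[z, x]] + z ** [[x, y]] = 0.
Proof.
apply: mulr2n_eq0; rewrite !mulrnDl !tp_leibniz.
rewrite (tp_mulC y x) (tp_mulC z x) (tp_mulC z y).
rewrite (br_antisym y (x ** z)) (br_antisym z (x ** y)) (br_antisym x (y ** z)).
by rewrite [X in X + _]addrC !addrA !addrNK subrr.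
Qed.

(** This is [S + T = 0] for the sums [S] and [T] described above. *)
Lemma br_mul_br_cyclic_add h x y z :
  [[h ** [[x, y]], z]] + [[h ** [[y, z]], x]] + [[h ** [[z, x]], y]]
  + ([[[[x, y]], h ** z]] + [[[[y, z]], h ** x]] + [[[[z, x]], h ** y]]) = 0.
Proof.
have := congr1 (fun w => (h ** w) *+ 2) (br_jacobi_l x y z).
rewrite linear0r mul0rn !linearDr !mulrnDl !tp_leibniz => <-.
sum_perm.
Qed.

(** This is [2S + T = 0] for the same two sums. *)
Lemma br_mul_br_cyclic_double h x y z :
  ([[h ** [[x, y]], z]] + [[h ** [[y, z]], x]] + [[h ** [[z, x]], y]]) *+ 2
  + ([[[[x, y]], h ** z]] + [[[[y, z]], h ** x]] + [[[[z, x]], h ** y]]) = 0.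
Proof.
have dbl a b c : [[h ** [[a, b]], c]] *+ 2
    = [[[[h ** a, b]], c]] + [[[[a, h ** b]], c]].
  by rewrite -linearDl -tp_leibniz linearMnl.
rewrite !mulrnDl !dbl.
transitivity (0 + 0 + 0 : L); last by rewrite !addr0.
(* The Jacobi identity with [h] multiplied into each argument in turn. *)
rewrite -{1}(br_jacobi_l (h ** x) y z) -{1}(br_jacobi_l x (h ** y) z).
rewrite -{1}(br_jacobi_l x y (h ** z)).
sum_perm.
Qed.

Lemma br_mul_br_cyclic h x y z :
  [[h ** [[x, y]], z]] + [[h ** [[y, z]], x]] + [[h ** [[z, x]], y]] = 0.
Proof.
have := br_mul_br_cyclic_double h x y z.
by rewrite mulr2n -addrA br_mul_br_cyclic_add addr0.
Qed.

Lemma br_br_mul_cyclic h x y z :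
  [[[[x, y]], h ** z]] + [[[[y, z]], h ** x]] + [[[[z, x]], h ** y]] = 0.
Proof.
by have := br_mul_br_cyclic_add h x y z; rewrite br_mul_br_cyclic add0r.
Qed.

(** Rewriting each product by [mul_br_cyclic] and collecting by the Jacobi
    identity, the sum is [- (x[h,[y,z]] + y[h,[z,x]] + z[h,[x,y]])]; the double
    of this splits into a [br_br_mul_cyclic] part and the bracket of [h] with a
    [mul_br_cyclic] sum. *)
Lemma br_mul_br_plucker h x y z :
  [[h, x]] ** [[y, z]] + [[h, y]] ** [[z, x]] + [[h, z]] ** [[x, y]] = 0.
Proof.
have ad_sum : x ** [[h, [[y, z]]]] + y ** [[h, [[z, x]]]]
              + z ** [[h, [[x, y]]]] = 0.
  have adh : [[h, x ** [[y, z]]]] + [[h, y ** [[z, x]]]]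
             + [[h, z ** [[x, y]]]] = 0.
    by rewrite -!linearDr mul_br_cyclic linear0r.
  have hb : [[x ** h, [[y, z]]]] + [[y ** h, [[z, x]]]]
            + [[z ** h, [[x, y]]]] = 0.
    rewrite !(tp_mulC _ h) !(br_antisym (h ** _)) -!opprD.
    by rewrite br_br_mul_cyclic oppr0.
  apply: mulr2n_eq0; rewrite !mulrnDl !tp_leibniz -[RHS]addr0 -{1}hb -adh.
  sum_perm.
have step a b c : [[h, a]] ** [[b, c]]
    = - (b ** [[c, [[h, a]]]] + c ** [[[[h, a]], b]]).
  by apply/eqP; rewrite -addr_eq0 addrA mul_br_cyclic.
have adD a b : [[h, [[a, b]]]] = [[a, [[h, b]]]] + [[[[h, a]], b]].
  apply/eqP; rewrite -subr_eq0 opprD addrA (br_antisym h b) linearNr opprK.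
  by rewrite (br_antisym [[h, a]]) opprK br_jacobi.
rewrite !step -!opprD -[RHS]oppr0 -ad_sum !adD !linearDr.
congr (- _); sum_perm.
Qed.

(** The two instances of [mul_br_cyclic] that contain the right-hand terms turn
    the right-hand side into
    [- (x([yw,z] + [y,zw]) + y[z,x]w + z[x,y]w)], where the first summand is
    [2 x[y,z]w]. *)
Lemma mul_br_exchange w x y z :
  - (x ** [[y, z]] ** w) = z ** [[x, y ** w]] + y ** [[z ** w, x]].
Proof.
have e1 := mul_br_cyclic z x (y ** w).
have e2 := mul_br_cyclic y (z ** w) x.
have e3 : x ** [[y, z]] ** w + y ** [[z, x]] ** w + z ** [[x, y]] ** w = 0.
  by rewrite -!linearDl mul_br_cyclic linear0l.
have e4 : x ** [[y ** w, z]] + x ** [[y, z ** w]]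
    = x ** [[y, z]] ** w + x ** [[y, z]] ** w.
  rewrite -linearDr !(tp_mulC _ w) -tp_leibniz -mulr2n linearMnr /=.
  by rewrite !tp_mulA (tp_mulC x).
apply: (@addIr _ (x ** [[y, z]] ** w + (x ** [[y, z]] ** w
          + y ** [[z, x]] ** w + z ** [[x, y]] ** w))).
rewrite addrA addNr [in LHS]e3 addr0.
transitivity (0 + 0 : L); first by rewrite addr0.
rewrite -{1}e1 -e2 (tp_mulAC y w) (tp_mulAC z w).
rewrite (addrA (x ** _ ** w)) (addrA (x ** _ ** w)) -e4.
sum_perm.
Qed.

(** By [mul_br_exchange], the difference of the two sides is [a] times an
    instance of [br_mul_br_cyclic]. *)
Lemma mul_br_mul_br a b v y z :
  b ** [[v, a ** [[y, z]]]]
  = - (v ** [[a, b]] ** [[y, z]]) + a ** [[y, b ** [[v, z]]]]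
    + a ** [[b ** [[v, y]], z]].
Proof.
rewrite mul_br_exchange -!addrA -[LHS]addr0; congr (_ + _).
rewrite -!linearDr -(linear0r mul a); congr (a ** _).
rewrite -(br_mul_br_cyclic b y z v) (br_antisym y (b ** _)).
rewrite (br_antisym v z) !linearNr linearNl opprK.
sum_perm.
Qed.

(** * The ternary operation of a derivation *)

Variable D : {linear L -> L}.
Hypothesis mulD : is_derivation mul D.
Hypothesis brD : is_derivation br D.

Local Notation t := (ternary_op mul br D).

Lemma D_ternary x y z :
  D (t x y z)
  = D (D x) ** [[y, z]] + D (D y) ** [[z, x]] + D (D z) ** [[x, y]]
    + (- (x ** [[D y, D z]]) - y ** [[D z, D x]] - z ** [[D x, D y]]).
Proof.
(* [mul_br_cyclic] merges, for each plain argument [a], the two terms where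
   the other arguments carry one [D] each. *)
have first_order a b c : - (a ** [[b, c]]) = b ** [[c, a]] + c ** [[a, b]].
  by apply/eqP; rewrite eq_sym -addr_eq0 addrC addrA mul_br_cyclic.
rewrite /ternary_op !linearD !mulD !brD !linearDr !first_order /=.
sum_perm.
Qed.

Lemma ternary_trilinear : trilinear t.
Proof.
have linD k (a b : L) : D (k *: a + b) = k *: D a + D b by rewrite linearP.
have linl (f : {bilinear L -> L -> L}) k a b c :
    f (k *: a + b) c = k *: f a c + f b c by rewrite linearPl.
have linr (f : {bilinear L -> L -> L}) k a b c :
    f c (k *: a + b) = k *: f c a + f c b by rewrite linearPr.
split=> [y z|x z|x y] k a b; rewrite /ternary_op linD !(linl, linr) !scalerDr;
  sum_perm.
Qed.

Lemma ternary_skew : skew_symmetric3 t.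
Proof.
split=> x y z; rewrite /ternary_op (br_antisym x z) (br_antisym z y);
  by rewrite (br_antisym y x) !linearNr -!opprD; congr (- _); sum_perm.
Qed.

Lemma ternary_fundamental x y z u v :
  t (t x y z) u v = t (t x u v) y z + t (t y u v) z x + t (t z u v) x y.
Proof.
have tE a b c : t a b c = D a ** [[b, c]] + D b ** [[c, a]] + D c ** [[a, b]].
  by [].
have plucker a h : a ** [[h, x]] ** [[y, z]] + a ** [[h, y]] ** [[z, x]]
                   + a ** [[h, z]] ** [[x, y]] = 0.
  by rewrite -!tp_mulA -!linearDr br_mul_br_plucker linear0r.
have plucker' a h : a ** [[x, h]] ** [[y, z]] + a ** [[y, h]] ** [[z, x]]
                   + a ** [[z, h]] ** [[x, y]] = 0.
  rewrite !(br_antisym _ h) !linearNr !linearNl -!opprD.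
  by rewrite plucker oppr0.
have cyclic c : - (x ** c ** [[y, z]]) - y ** c ** [[z, x]]
                - z ** c ** [[x, y]] = 0.
  rewrite !(tp_mulC _ c) -!tp_mulA -!opprD -!linearDr.
  by rewrite mul_br_cyclic linear0r oppr0.
(* [mul_br_mul_br] with its brackets reversed, as needed for the terms in [v']. *)
have mixed a b w p q :
    b ** [[a ** [[p, q]], w]]
    = - (w ** [[b, a]] ** [[p, q]]) + a ** [[p, b ** [[q, w]]]]
      + a ** [[b ** [[p, w]], q]].
  rewrite (br_antisym _ w) (br_antisym b) (br_antisym q) (br_antisym p w).
  by rewrite !linearNr mul_br_mul_br !linearNl !linearNr !opprD.
rewrite !(tE (t _ _ _)) !D_ternary !tE !linearDr !linearDl !linearDr /=.
rewrite !linearNl.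
rewrite !(mul_br_exchange [[u, v]]) !(tp_mulAC _ _ [[u, v]]).
rewrite !(mul_br_mul_br _ (D u) v) !(mixed _ (D v) u).
(* The remaining terms of the right-hand side form three vanishing sums, which
   are added to the left-hand side. *)
rewrite -[LHS]addr0 -{1}(plucker (D (D u)) v) -[LHS]addr0.
rewrite -{1}(plucker' (D (D v)) u) -[LHS]addr0 -{1}(cyclic [[D u, D v]]).
sum_perm.
Qed.

End TransposedPoisson.

Theorem theorem4p5 (K : fieldType) (K_char0 : [pchar K] =i pred0)
    (L : lmodType K) (mul br : {bilinear L -> L -> L}) (D : {linear L -> L}) :
  transposed_poisson_algebra mul br ->
  is_derivation mul D ->
  is_derivation br D ->
  three_lie_algebra (ternary_op mul br D).
Proof.
move=> tpL mulD brD.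
have two_neq0 : 2%:R != 0 :> K by rewrite (pcharf0P K).1.
split.
- exact: ternary_trilinear.
- exact: ternary_skew.
- exact: ternary_fundamental.
Qed.
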